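(* For any prime $p\ge 5$, $$\sum_{k=0}^{(p-1)/2}\frac{\binom{4k}{2k}\binom{2k}{k}}{(2k+1)\,64^k}\equiv (-1)^{\frac{p-1}{2}}\left(2^{p-1}-(2^{p-1}-1)^2\right)\pmod{p^3}.$$
   Context: For rational numbers $x,y$ and a positive integer $m$, $x\equiv y\pmod{p^m}$ means that $x-y\in p^m\mathbb{Z}_{(p)}$, where $\mathbb{Z}_{(p)}$ is the ring of rational numbers whose denominator (in lowest terms) is not divisible by $p$. *)

(* Defs.v *)
From mathcomp Require Import all_boot all_order all_algebra.

Set Implicit Arguments.
Unset Strict Implicit.
Unset Printing Implicit Defensive.

Import GRing.Theory Num.Theory.
Local Open Scope ring_scope.

(* The ring Z_(p), as a predicate on rat; [denq] is the positive denominator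
   of the reduced fraction. *)
Definition Zloc (p : nat) : pred rat := [pred x | ~~ (p%:Z %| denq x)%Z].

Definition eqmod_Zloc (p m : nat) (x y : rat) : Prop :=
  exists2 z : rat, z \in Zloc p & x - y = p%:R ^+ m * z.

(* Main.v *)
Require Import Defs.
From mathcomp Require Import all_boot all_order all_algebra.
From mathcomp Require Import ring zify.
From HB Require Import structures.

Import GRing.Theory Num.Theory.

Local Open Scope ring_scope.

Set Implicit Arguments.
Unset Strict Implicit.
Unset Printing Implicit Defensive.

(** Write n = (p-1)/2.  The coefficient C(4k,2k) C(2k,k) / 64^k is the value
    at a = -1/4 of
      c_k(a) = prod_(j < k) (j-a)(j+1+a)/(j+1)^2 = C(a,k) C(-1-a,k),
    and also its value at -3/4, since c_k(-1-a) = c_k(a).  So the sum is the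
    value of S_n(a) = sum_(k <= n) c_k(a)/(2k+1) at either point.  The polynomial
    Q(a) = (2a+1) S_n(a) takes the value 1 at 0, ..., n and -1 at
    -1, ..., -n-1; accordingly its difference has the product form
      Q(a) - Q(a-1) = 2 prod_(j=1..n) (1 - a^2/j^2)      (hypS_step).
    Put x = -p/4 and m = floor(n/2).  Then x + m is -1/4 or -3/4 according to
    the parity of n, so Q at that point is Q(x) plus the m differences between
    x and x + m (hypS_walk), and the factor 2a+1 = 1/2 or -1/2 produces the sign
    (-1)^n.  All these numbers are x plus a small integer, that
    is, p-adically close to an integer, which makes each piece computable modulo
    p^3 in terms of the harmonic number H = 1 + 1/2 + ... + 1/n.

    With h = pH the pieces are as follows, modulo p^3 unless another modulus is
    named.
    - Q(x) = (1 + h)/2 (hypS_base): a partial fraction expansion.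
    - The r-th difference is 2x/(x+r) times a product that can be followed from
      r to r+1 by an exact recurrence and equals 1 + 2p(1 + 1/3 + ... +
      1/(2r-1)) modulo p^2.  The total is -z - p^2 D (sinprod_walk_sum), where
      -z is the truncated logarithm of the product of the 1 - p/(2r) over r <= m
      and D is a double harmonic sum needed modulo p only.
    - z = 3h/4 (quarter_log).  A harmonic number of index p/4 alone does not
      have an elementary value modulo p^2, but z does, because the square of
      that product is exactly the product of prod (1 - p/k) and
      prod (1 - p/(2k)), k <= n (quarter_prod_sqr).
    - Modulo p, D is the square of a harmonic sum over the odd numbers below p/2
      (mixharm_quarter), because the sum of 1/(js) over odd j < even s < p
      vanishes modulo p (mixharm_half_eq0); hence p^2 D = (h/4)^2.
    Finally prod (1 - p/k) = 2^(p-1) prod (1 - p/(2k)) exactly, so that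
    2^(p-1) = 1 - h/2 + h^2/8 (two_pow_eq), and the values
    (1 + h)/2 - 3h/4 - h^2/16 and (t - (t-1)^2)/2 with t = 2^(p-1) coincide
    modulo p^3. *)

(** * Reindexing sums and products *)

Section Reindexing.

Variables (V : Type) (idx : V) (op : Monoid.com_law idx).
Implicit Types (f F G : nat -> V).

Lemma big_nat_odd_even N f :
  \big[op/idx]_(1 <= k < N.+1) f k =
  op (\big[op/idx]_(0 <= a < N - N./2) f (2 * a + 1)%N)
     (\big[op/idx]_(1 <= b < N./2.+1) f (2 * b)%N).
Proof.
elim: N => [|N IH]; first by rewrite !big_nil Monoid.mul1m.
rewrite (big_nat_recr N.+1) //= IH uphalf_half.
case: (boolP (odd N)) => oN /=.
  have -> : (N.+1 - (1 + N./2) = N - N./2)%N by lia.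
  rewrite add1n (big_nat_recr N./2.+1) //= -Monoid.mulmA.
  by congr (op _ (op _ (f _))); lia.
have -> : (N.+1 - (0 + N./2) = (N - N./2).+1)%N by lia.
rewrite add0n (big_nat_recr (N - N./2)) //= -[LHS]Monoid.mulmA
  -[RHS]Monoid.mulmA.
by congr (op _ _); rewrite [RHS]Monoid.mulmC; congr (op _ (f _)); lia.
Qed.

Lemma big_nat_rev_shift n j F : (j <= n)%N ->
  \big[op/idx]_(j.+1 <= b < n.+1) F b =
  \big[op/idx]_(0 <= a < n - j) F (n - a)%N.
Proof.
move=> jn; rewrite big_nat_rev /= -{1}[j.+1]add0n big_addn subSS.
by apply: eq_big_nat => a /andP[_ an]; congr F; lia.
Qed.

Lemma big_nat_rev_sub n c m G : (c <= m <= n)%N ->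
  \big[op/idx]_(n - m <= a < n - c) G a =
  \big[op/idx]_(c.+1 <= d < m.+1) G (n - d)%N.
Proof.
move=> /andP[cm mn]; rewrite big_nat_rev_shift // -{1}[(n - m)%N]add0n big_addn.
have -> : (n - c - (n - m) = m - c)%N by lia.
by apply: eq_big_nat => a /andP[_ ha]; congr G; lia.
Qed.

Lemma exchange_big_triangle n K (H : nat -> nat -> V) :
    (n <= K)%N ->
  \big[op/idx]_(1 <= b < n.+1) \big[op/idx]_(0 <= a < b) H a b =
  \big[op/idx]_(0 <= a < K) \big[op/idx]_(a.+1 <= b < n.+1) H a b.
Proof.
move=> nK; rewrite (big_cat_nat (n := n) _ nK) //=.
rewrite [X in _ = op _ X]big_nat [X in _ = op _ X]big1 ?Monoid.mulm1;
  last first.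
  by move=> a /andP[na _]; rewrite big_geq.
elim: n {nK} => [|n IH]; first by rewrite !big_nil.
rewrite (big_nat_recr n.+1) //= IH.
rewrite [RHS]big_nat_recr //= [\big[op/idx]_(n.+1 <= b < n.+2) _]big_nat1.
rewrite [X in op _ X = _]big_nat_recr //= [LHS]Monoid.mulmA.
congr (op _ _).
rewrite [RHS](eq_big_nat _ _ (F2 := fun a =>
  op (\big[op/idx]_(a.+1 <= b < n.+1) H a b) (H a n.+1))) ?big_split //.
by move=> a /andP[_ an]; rewrite [LHS]big_nat_recr // leqW.
Qed.

End Reindexing.

(** * Polynomials interpolating the sign *)

Section Interpolation.

Variable R : numFieldType.
Implicit Types (a x : R) (n k r : nat).

(** The product C(a,k) C(-1-a,k), written so that it makes sense for every
    [a]. *)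
Definition hypc a k : R :=
  \prod_(0 <= j < k) ((j%:R - a) * (j%:R + 1 + a) / (j%:R + 1) ^+ 2).

Definition hypS n a : R := \sum_(0 <= k < n.+1) hypc a k / (2 * k + 1)%:R.

Definition sinprod n a : R := \prod_(1 <= j < n.+1) (1 - a ^+ 2 / j%:R ^+ 2).

Lemma natr_succ_neq0 k : (k%:R + 1 : R) != 0.
Proof. by rewrite natr1 pnatr_eq0. Qed.

Lemma hypcS a k : hypc a k.+1 =
  hypc a k * ((k%:R - a) * (k%:R + 1 + a) / (k%:R + 1) ^+ 2).
Proof. by rewrite /hypc big_nat_recr. Qed.

Lemma sinprodS n a :
  sinprod n.+1 a = sinprod n a * (1 - a ^+ 2 / (n%:R + 1) ^+ 2).
Proof. by rewrite /sinprod big_nat_recr //= natr1. Qed.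

Lemma hypc_refl a k : hypc (- 1 - a) k = hypc a k.
Proof. by apply: eq_bigr => j _; congr (_ / _); ring. Qed.

(** The factors of c_(k+1)(a) run over a-k, ..., a+k+1.  Pairing a-j with a+j
    leaves a and a+k+1 alone; for c_(k+1)(a-1) the factors left are a and
    a-k-1. *)
Lemma hypc_sinprod a k :
  hypc a k.+1 = - a * (a + k%:R + 1) / (k%:R + 1) ^+ 2 * sinprod k a.
Proof.
elim: k => [|k IH].
  by rewrite hypcS /hypc /sinprod !big_nil; field.
rewrite hypcS IH sinprodS -natr1; field.
by rewrite !natr_succ_neq0 natr1 natr_succ_neq0.
Qed.

Lemma hypc_pred_sinprod a k :
  hypc (a - 1) k.+1 = - a * (a - k%:R - 1) / (k%:R + 1) ^+ 2 * sinprod k a.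
Proof.
rewrite -hypc_refl; have -> : - 1 - (a - 1) = - a by ring.
rewrite hypc_sinprod; have -> : sinprod k (- a) = sinprod k a.
  by apply: eq_bigr => j _; rewrite sqrrN.
by congr (_ * _); field; rewrite natr_succ_neq0.
Qed.

Lemma hypc_eq_sinprod a k : (a - k%:R) * hypc a k = a * sinprod k a.
Proof.
case: k => [|k]; first by rewrite /hypc /sinprod !big_nil subr0.
rewrite hypc_sinprod sinprodS -natr1; field.
by rewrite natr_succ_neq0.
Qed.

(** By induction on n: the two summands of index n have the common factor
    [sinprod], and (2a+1)(a+n) - (2a-1)(a-n) = 2a(2n+1) cancels the denominator
    2n+1, in particular the denominator p of the last term. *)
Lemma hypS_step n a :
  (2 * a + 1) * hypS n a - (2 * a - 1) * hypS n (a - 1) = 2 * sinprod n a.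
Proof.
elim: n => [|n IH].
  by rewrite /hypS !big_nat1 /hypc /sinprod !big_nil muln0 divr1; ring.
have hS b : hypS n.+1 b = hypS n b + hypc b n.+1 / (2 * n.+1 + 1)%:R.
  by rewrite /hypS big_nat_recr.
have d0 : ((2 * n.+1 + 1)%:R : R) != 0 by rewrite pnatr_eq0 addn1.
rewrite !hS hypc_sinprod hypc_pred_sinprod sinprodS.
transitivity (2 * sinprod n a
    + ((2 * a + 1) * (- a * (a + n%:R + 1) / (n%:R + 1) ^+ 2 * sinprod n a)
     - (2 * a - 1) * (- a * (a - n%:R - 1) / (n%:R + 1) ^+ 2 * sinprod n a))
     / (2 * n.+1 + 1)%:R).
  rewrite mulrDr (mulrDr (2 * a - 1)) opprD addrACA IH.
  by congr (_ + _); rewrite [RHS]mulrBl !mulrA.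
have e : (2 * n.+1 + 1)%:R = 2 * (n%:R + 1) + 1 :> R.
  by rewrite natrD natrM -[n.+1%:R]natr1.
rewrite e in d0 *; field.
by rewrite natr_succ_neq0 d0.
Qed.

Lemma hypS_walk n m x :
  (2 * (x + m%:R) + 1) * hypS n (x + m%:R) =
  (2 * x + 1) * hypS n x + \sum_(1 <= r < m.+1) 2 * sinprod n (x + r%:R).
Proof.
elim: m => [|m IH]; first by rewrite big_nil !addr0.
rewrite big_nat_recr //= addrA -IH -hypS_step -[m.+1%:R]natr1.
have -> : x + (m%:R + 1) - 1 = x + m%:R by ring.
by ring.
Qed.

(** Both sides are the product of the a+i over -n <= i <= n+1, up to a
    constant. *)
Lemma sinprod_step n a :
  (a + 1) * (a - n%:R) * sinprod n (a + 1)
  = a * (a + n%:R + 1) * sinprod n a.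
Proof.
elim: n => [|n IH]; first by rewrite /sinprod !big_nil; ring.
rewrite !sinprodS -natr1.
have n0 := natr_succ_neq0 n.
transitivity ((a + 1) * (a - n%:R) * sinprod n (a + 1)
   * (- (a - (n%:R + 1)) * (a + n%:R + 2) / (n%:R + 1) ^+ 2)).
  by field.
by rewrite IH; field.
Qed.

Lemma sinprod_walk n r x : (forall i, (i < r)%N -> x + i%:R - n%:R != 0) ->
  (x + r%:R) * sinprod n (x + r%:R) = x * sinprod n x *
    \prod_(0 <= i < r) ((x + i%:R + n%:R + 1) / (x + i%:R - n%:R)).
Proof.
elim: r => [|r IH] h; first by rewrite big_nil addr0 mulr1.
rewrite big_nat_recr //= mulrA -IH => [|i ir]; last exact/h/ltnW.
have h0 := h r (ltnSn r); have := sinprod_step n (x + r%:R).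
rewrite -natr1 addrA => e; apply: (mulIf h0).
by rewrite mulrAC e; field.
Qed.

Lemma hypc_quarter k : hypc (- 4^-1) k =
  ('C(4 * k, 2 * k) * 'C(2 * k, k))%:R / 64 ^+ k.
Proof.
elim: k => [|k IH]; first by rewrite /hypc big_nil bin0 muln1 expr0 divr1.
rewrite hypcS IH [64 ^+ k.+1]exprS.
have rec : ('C(4 * k.+1, 2 * k.+1) * 'C(2 * k.+1, k.+1) * (k.+1 * k.+1) =
   'C(4 * k, 2 * k) * 'C(2 * k, k) * (4 * (4 * k + 1) * (4 * k + 3)))%N.
  have h4 j : ('C(4 * j, 2 * j) * 'C(2 * j, j) * ((2 * j)`! * (j`! * j`!)) =
      (4 * j)`!)%N.
    have e1 := @bin_fact (4 * j) (2 * j) ltac:(lia).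
    have e2 := @bin_fact (2 * j) j ltac:(lia).
    have -> : (4 * j)`! = ('C(4 * j, 2 * j) * ((2 * j)`! * (2 * j)`!))%N.
      by rewrite -e1; do 3 f_equal; lia.
    have <- : ('C(2 * j, j) * (j`! * j`!) = (2 * j)`!)%N.
      by rewrite -e2; do 3 f_equal; lia.
    by ring.
  have e := h4 k.+1; have e' := h4 k.
  have -> : (4 * k.+1 = (4 * k).+4)%N by lia.
  move: e; have -> : (4 * k.+1 = (4 * k).+4)%N by lia.
  have -> : (2 * k.+1 = (2 * k).+2)%N by lia.
  rewrite !factS -e'.
  set A := ('C(_, _) * _)%N; set B := ('C(_, _) * _)%N => e.
  have f0 : (0 < (2 * k)`! * (k`! * k`!) * ((2 * k).+1 * (2 * k).+2))%N.
    by rewrite !muln_gt0 !fact_gt0.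
  apply/eqP; rewrite -(eqn_pmul2r f0); apply/eqP.
  transitivity (A * ((2 * k).+2 * ((2 * k).+1 * (2 * k)`!) *
     (k.+1 * k`! * (k.+1 * k`!))))%N; first by ring.
  by rewrite e; ring.
have k0 := natr_succ_neq0 k.
have rec' : ('C(4 * k.+1, 2 * k.+1) * 'C(2 * k.+1, k.+1))%:R
   = ('C(4 * k, 2 * k) * 'C(2 * k, k))%:R
    * (4 * (4 * k%:R + 1) * (4 * k%:R + 3)) / (k%:R + 1) ^+ 2 :> R.
  apply: (mulIf (expf_neq0 2 k0)); rewrite divfK ?expf_neq0 //.
  have -> : k%:R + 1 = k.+1%:R :> R by rewrite natr1.
  rewrite expr2 -[k.+1%:R * _]natrM -[LHS]natrM rec natrM; congr (_ * _).
  by rewrite natrM (natrM _ 4) (natrD _ (4 * k) 1) (natrD _ (4 * k) 3) natrM.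
have q0 : 64 ^+ k != 0 :> R by rewrite expf_neq0 // pnatr_eq0.
by rewrite rec'; set q := 64 ^+ k in q0 *; set c := (_ * _)%:R; field;
  rewrite q0.
Qed.

End Interpolation.

(** * Harmonic sums and central products *)

Definition harm K : rat := \sum_(1 <= k < K.+1) k%:R^-1.
Definition oddharm K : rat := \sum_(0 <= a < K) (2 * a + 1)%:R^-1.
Definition mixharm K : rat := \sum_(1 <= b < K.+1) oddharm b / b%:R.

Lemma prod_high_odd n :
  \prod_(n.+1 <= i < (2 * n).+1) (i%:R : rat) =
  2 ^+ n * \prod_(1 <= k < n.+1) (2 * k - 1)%:R.
Proof.
elim: n => [|n IH]; first by rewrite !big_nil mulr1.
have n0 : (n.+1%:R : rat) != 0 by rewrite pnatr_eq0.
apply: (mulfI n0); rewrite -big_ltn; last by lia.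
have -> : (2 * n.+1 = (2 * n).+2)%N by lia.
rewrite big_nat_recr /=; last by lia.
rewrite big_nat_recr /=; last by lia.
rewrite IH exprS [in RHS]big_nat_recr //=.
have -> : (2 * n.+1 - 1 = (2 * n).+1)%N by lia.
have -> : ((2 * n).+2 = 2 * n.+1)%N by lia.
by rewrite natrM; ring.
Qed.

(** Up to the same sign, the numerators are (n+1)...(2n) on the left and
    1*3*...*(2n-1) on the right, and their quotient is 2^n; the denominators
    contribute the other 2^n. *)
Lemma prod_half_index n (q := (2 * n).+1) :
  \prod_(1 <= k < n.+1) (1 - q%:R / k%:R) =
  4 ^+ n * \prod_(1 <= k < n.+1) (1 - q%:R / (2 * k)%:R) :> rat.
Proof.
have -> : \prod_(1 <= k < n.+1) (1 - q%:R / k%:R)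
    = \prod_(n.+1 <= i < q) i%:R * \prod_(1 <= k < n.+1) - k%:R^-1 :> rat.
  have -> : \prod_(n.+1 <= i < q) (i%:R : rat)
     = \prod_(1 <= k < n.+1) (q - k)%:R.
    rewrite [RHS]big_nat_rev_shift //= -{1}[n.+1]add0n big_addn /q.
    have -> : ((2 * n).+1 - n.+1 = n - 0)%N by lia.
    by apply: eq_big_nat => i hi; congr _%:R; lia.
  rewrite -big_split; apply: eq_big_nat => k hk /=.
  by rewrite natrB /q; [field; rewrite pnatr_eq0 -lt0n | ]; lia.
rewrite prod_high_odd.
have -> : \prod_(1 <= k < n.+1) (1 - q%:R / (2 * k)%:R)
   = \prod_(1 <= k < n.+1) (2 * k - 1)%:R *
     \prod_(1 <= k < n.+1) (2^-1 * - k%:R^-1) :> rat.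
  have -> : \prod_(1 <= k < n.+1) ((2 * k - 1)%:R : rat)
     = \prod_(1 <= k < n.+1) (q - 2 * k)%:R.
    rewrite big_nat_rev /=; apply: eq_big_nat => k hk; congr _%:R.
    by rewrite /q; lia.
  rewrite -big_split; apply: eq_big_nat => k hk /=.
  by rewrite natrB /q; [rewrite natrM; field; rewrite pnatr_eq0 -lt0n | ]; lia.
rewrite [\prod_(1 <= k < n.+1) (2^-1 * _)]big_split /= prodr_const_nat subn1 /=.
rewrite exprVn (_ : 4 = 2 * 2) // exprMn.
have e0 : (2 ^+ n : rat) != 0 by rewrite expf_neq0.
by field.
Qed.

(** * Congruences in the localization of Z at p *)

Section Localization.

Variable p : nat.
Hypothesis p_prime : prime p.

Local Notation P := (p%:R : rat).
Local Notation "x = y %[p^ k ]" := (eqmod_Zloc p k x y)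
  (at level 70, y at next level, k at level 0,
   format "x  =  y  %[p^ k ]") : ring_scope.

Lemma Zloc_frac (a b : int) : ~~ (p %| b)%Z -> a%:~R / b%:~R \in Zloc p.
Proof.
move=> pb; rewrite inE; apply: contra pb => pd.
have [->|b0] := eqVneq b 0; first exact: dvdz0.
have b0' : (b%:~R : rat) != 0 by rewrite intr_eq0.
set x := a%:~R / b%:~R in pd *.
have e : (numq x * b = a * denq x)%R.
  apply: (@intr_inj rat); rewrite !intrM numqE mulrAC.
  by rewrite /x divfK.
apply: (dvdz_trans pd); rewrite -(@Gauss_dvdzr _ (numq x)); last first.
  by rewrite coprimez_sym /coprimez /gcdz; apply: coprime_num_den.
by rewrite e dvdz_mull.
Qed.

Lemma Zloc_fracP (x : rat) : x \in Zloc p ->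
  exists a b : int, ~~ (p %| b)%Z /\ x = a%:~R / b%:~R.
Proof.
by rewrite inE => px; exists (numq x), (denq x); rewrite divq_num_den.
Qed.

Lemma dvdz_prime_mul (a b : int) :
  (p %| a * b)%Z = (p %| a)%Z || (p %| b)%Z.
Proof. by rewrite !dvdzE abszM Euclid_dvdM. Qed.

Lemma Zloc_den_neq0 (b : int) : ~~ (p %| b)%Z -> (b%:~R : rat) != 0.
Proof. by move=> pb; rewrite intr_eq0; apply: contraNneq pb => ->. Qed.

Lemma Zloc_subring : subring_closed (Zloc p).
Proof.
split=> [|x y|x y].
- by rewrite inE /= dvdzE /= dvdn1; case: p p_prime => [|[]].
- move=> /Zloc_fracP[a [b [pb ->]]] /Zloc_fracP[c [d [pd ->]]].
  have -> : a%:~R / b%:~R - c%:~R / d%:~R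
      = (a * d - c * b)%:~R / (b * d)%:~R :> rat.
    rewrite !(intrB, intrM); field.
    by rewrite !Zloc_den_neq0.
  by apply: Zloc_frac; rewrite dvdz_prime_mul negb_or pb.
- move=> /Zloc_fracP[a [b [pb ->]]] /Zloc_fracP[c [d [pd ->]]].
  rewrite mulf_div -!intrM.
  by apply: Zloc_frac; rewrite dvdz_prime_mul negb_or pb.
Qed.

HB.instance Definition _ :=
  GRing.isSubringClosed.Build rat (Zloc p) Zloc_subring.

Lemma Zloc_nat_inv (k : nat) : ~~ (p %| k)%N -> (k%:R^-1 : rat) \in Zloc p.
Proof.
move=> pk; rewrite -[_^-1]mul1r; exact: (@Zloc_frac 1 k%:Z).
Qed.

Lemma Zloc_1p_inv (w : rat) : w \in Zloc p ->
  1 + P * w != 0 /\ (1 + P * w)^-1 \in Zloc p.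
Proof.
move=> /Zloc_fracP[a [b [pb ->]]].
have b0 := Zloc_den_neq0 pb.
have pc : ~~ (p %| b + p%:Z * a)%Z.
  by rewrite rpredDr // dvdz_mulr.
have c0 := Zloc_den_neq0 pc.
have -> : 1 + P * (a%:~R / b%:~R) = (b + p%:Z * a)%:~R / b%:~R :> rat.
  by rewrite intrD intrM; field.
by rewrite invf_div; split; [rewrite mulf_neq0 ?invr_neq0 | exact: Zloc_frac].
Qed.

Lemma Zloc_thick_inv (u w : rat) :
    u \in Zloc p -> u != 0 -> u^-1 \in Zloc p -> w \in Zloc p ->
  u + P * w != 0 /\ (u + P * w)^-1 \in Zloc p.
Proof.
move=> zu u0 zu' zw; have [h1 h2] := Zloc_1p_inv (rpredM zw zu').
have -> : u + P * w = u * (1 + P * (w / u)) by field.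
by rewrite invfM mulf_neq0 // rpredM.
Qed.

Lemma eqm_refl k x : x = x %[p^ k].
Proof. by exists 0; rewrite ?rpred0 // subrr mulr0. Qed.

Lemma eqm_sym k x y : x = y %[p^ k] -> y = x %[p^ k].
Proof. by case=> z zz e; exists (- z); rewrite ?rpredN // mulrN -e opprB. Qed.

Lemma eqmD k x y x' y' :
  x = y %[p^ k] -> x' = y' %[p^ k] -> x + x' = y + y' %[p^ k].
Proof.
move=> [z zz e] [z' zz' e']; exists (z + z'); first exact: rpredD.
by rewrite mulrDr -e -e'; ring.
Qed.

Lemma eqm_trans k x y z : x = y %[p^ k] -> y = z %[p^ k] -> x = z %[p^ k].
Proof.
move=> [a za ea] [b zb eb]; exists (a + b); first exact: rpredD.
by rewrite mulrDr -ea -eb; ring.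
Qed.

Lemma eqmMl k c x y : c \in Zloc p -> x = y %[p^ k] -> c * x = c * y %[p^ k].
Proof.
move=> zc [z zz e]; exists (c * z); first exact: rpredM.
by rewrite -mulrBr e; ring.
Qed.

Lemma eqmN k x y : x = y %[p^ k] -> - x = - y %[p^ k].
Proof.
by rewrite -[- x]mulN1r -[- y]mulN1r; apply: eqmMl; rewrite rpredN rpred1.
Qed.

Lemma eqmB k x y x' y' :
  x = y %[p^ k] -> x' = y' %[p^ k] -> x - x' = y - y' %[p^ k].
Proof. by move=> h h'; apply: eqmD => //; apply: eqmN. Qed.

Lemma eqmM k x y x' y' : x' \in Zloc p -> y \in Zloc p ->
  x = y %[p^ k] -> x' = y' %[p^ k] -> x * x' = y * y' %[p^ k].
Proof.
move=> zx' zy h h'; apply: (@eqm_trans _ _ (y * x')); last exact: eqmMl.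
by rewrite !(mulrC _ x'); apply: eqmMl.
Qed.

Lemma eqm_Zloc k x y : x = y %[p^ k] -> y \in Zloc p -> x \in Zloc p.
Proof.
move=> [z zz e] zy; rewrite -(subrK y x) e.
by rewrite rpredD // rpredM // rpredX // rpred_nat.
Qed.

Lemma eqm_weaken k l x y : (k <= l)%N -> x = y %[p^ l] -> x = y %[p^ k].
Proof.
move=> kl [z zz e]; exists (P ^+ (l - k) * z).
  by rewrite rpredM // rpredX // rpred_nat.
by rewrite e mulrA -exprD subnKC.
Qed.

(** Precision gained: a factor in p^k lets the other be known only modulo
    p^l. *)
Lemma eqmMp k l d x y :
  d = 0 %[p^ k] -> x = y %[p^ l] -> d * x = d * y %[p^ k + l].
Proof.
move=> [z zz]; rewrite subr0 => -> [w zw e]; exists (z * w).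
  exact: rpredM.
by rewrite -mulrBr e exprD; ring.
Qed.

Lemma eqm_sum k a b (F G : nat -> rat) :
  (forall i, (a <= i < b)%N -> F i = G i %[p^ k]) ->
  \sum_(a <= i < b) F i = \sum_(a <= i < b) G i %[p^ k].
Proof.
move=> h; rewrite !big_nat.
apply: (big_ind2 (fun x y => x = y %[p^ k])) => //; first exact: eqm_refl.
by move=> x1 x2 y1 y2; apply: eqmD.
Qed.

Lemma eqmIl k c x y : c != 0 -> c^-1 \in Zloc p ->
  c * x = c * y %[p^ k] -> x = y %[p^ k].
Proof. by move=> c0 zc /(eqmMl zc); rewrite !mulKf. Qed.

(** Nakayama's lemma for Z_(p) / p^k: 1 - p s is a unit. *)
Lemma eqm_selfmul k s x :
  s \in Zloc p -> x = P * s * x %[p^ k] -> x = 0 %[p^ k].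
Proof.
move=> zs; have [u0 zu] : 1 + P * (- s) != 0 /\ (1 + P * (- s))^-1 \in Zloc p.
  by apply: Zloc_1p_inv; rewrite rpredN.
move=> h; apply: (@eqmIl _ (1 + P * - s)) => //.
have -> : (1 + P * - s) * x = x - P * s * x by ring.
have -> : (1 + P * - s) * 0 = P * s * x - P * s * x by ring.
by apply: eqmB => //; apply: eqm_refl.
Qed.

Lemma eqm0P k x : x = 0 %[p^ k] <-> exists2 w, w \in Zloc p & x = P ^+ k * w.
Proof.
by split=> [] [w zw]; rewrite ?subr0 => e; exists w => //; rewrite ?subr0.
Qed.

Lemma Zloc_p : P \in Zloc p. Proof. exact: rpred_nat. Qed.

Hypothesis p_ge5 : (5 <= p)%N.

Lemma lt_p_unit (k : nat) : (0 < k < p)%N ->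
  (k%:R : rat) != 0 /\ (k%:R^-1 : rat) \in Zloc p.
Proof.
move=> /andP[k0 kp]; split; first by rewrite pnatr_eq0 -lt0n.
by apply: Zloc_nat_inv; rewrite gtnNdvd.
Qed.

Lemma Zloc_inv2 : (2^-1 : rat) \in Zloc p.
Proof. by apply: (lt_p_unit (k := 2) _).2; rewrite (leq_trans _ p_ge5). Qed.
Lemma Zloc_inv3 : (3^-1 : rat) \in Zloc p.
Proof. by apply: (lt_p_unit (k := 3) _).2; rewrite (leq_trans _ p_ge5). Qed.
Lemma Zloc_inv4 : (4^-1 : rat) \in Zloc p.
Proof. by apply: (lt_p_unit (k := 4) _).2; rewrite (leq_trans _ p_ge5). Qed.

(** Structural membership in Z_(p); only the inverses of 2, 3 and 4 and those
    recorded in the context are recognized. *)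
Ltac zloc :=
  lazymatch goal with
  | |- is_true (?e \in _) =>
    lazymatch e with
    | (_ + _)%R => apply: rpredD; zloc
    | (- _)%R => rewrite rpredN; zloc
    | (_ * _)%R => apply: rpredM; zloc
    | (_ ^+ _)%R => apply: rpredX; zloc
    | (_ *+ _)%R => apply: rpredMn; zloc
    | 1%R => exact: rpred1
    | 0%R => exact: rpred0
    | 2^-1%R => exact: Zloc_inv2
    | 3^-1%R => exact: Zloc_inv3
    | 4^-1%R => exact: Zloc_inv4
    | _ => try assumption
    end
  | _ => idtac
  end.

(** Here -Z is the logarithm of the product: modulo p^3 the series of
    -log(1-y) stops at y + y^2/2, and that of the exponential at its quadratic
    term. *)
Lemma prod_log K (y : nat -> rat) :
    (forall k, (1 <= k < K.+1)%N -> y k = 0 %[p^ 1]) ->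
  let Z := \sum_(1 <= k < K.+1) (y k + y k ^+ 2 / 2) in
  Z = 0 %[p^ 1] /\
  \prod_(1 <= k < K.+1) (1 - y k) = 1 - Z + Z ^+ 2 / 2 %[p^ 3].
Proof.
elim: K => [|K IH] hy /=.
  rewrite !big_nil; split; first exact: eqm_refl.
  by have -> : 1 - 0 + 0 ^+ 2 / 2 = 1 :> rat by []; apply: eqm_refl.
have [k hk|] := IH; first by apply: hy; case/andP: hk => -> /= /ltnW.
rewrite !(big_nat_recr K.+1) //=.
set Z := \sum_(_ <= _ < _) _.
have /eqm0P[w zw ->] : y K.+1 = 0 %[p^ 1] by apply: hy; rewrite ltnSn.
move=> /eqm0P[z zz ->] [s zs /eqP]; rewrite subr_eq => /eqP ->.
split.
  apply/eqm0P; exists (z + w + P * w ^+ 2 / 2); first by zloc.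
  by field.
exists (s * (1 - P * w) - (z ^+ 2 * w + (z + w) * w ^+ 2) / 2
         - P * w ^+ 2 ^+ 2 * 2^-1 ^+ 3).
  by zloc.
by field.
Qed.

(** * Harmonic sums modulo powers of p *)

Local Notation n := p./2.
Local Notation m := p./2./2.

Lemma p_half : p = (2 * n).+1.
Proof.
have : odd p by case: (even_prime p_prime) => // p2; move: p_ge5; rewrite p2.
by move=> po; rewrite -[LHS]odd_double_half po; lia.
Qed.

Lemma half_half_le : (m <= n)%N. Proof. lia. Qed.

Lemma inv_psub k : (0 < k < p)%N ->
  (p - k)%:R^-1 = - k%:R^-1 - P / k%:R ^+ 2 %[p^ 2].
Proof.
move=> kp; have [k0 zk] := lt_p_unit kp.
have /lt_p_unit[j0 zj] : (0 < p - k < p)%N by lia.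
exists (k%:R^-1 ^+ 2 / (p - k)%:R); first by zloc.
have e : (p - k)%:R = P - k%:R by rewrite natrB //; case/andP: kp => _ /ltnW.
by rewrite e in j0 *; field; rewrite k0 j0.
Qed.

Lemma inv_psub1 k : (0 < k < p)%N -> (p - k)%:R^-1 = - k%:R^-1 %[p^ 1].
Proof.
move=> kp; have [k0 zk] := lt_p_unit kp.
apply: eqm_trans (eqm_weaken (leqnSn 1) (inv_psub kp)) _.
by exists (- k%:R^-1 ^+ 2); [zloc | field].
Qed.

(** The reflection k -> p - k exchanges the odd and the even numbers. *)
Lemma odd_reflect (V : Type) (idx : V) (op : Monoid.com_law idx) f j :
    (j <= n)%N ->
  \big[op/idx]_(0 <= a < n - j) f (2 * a + 1)%N =
  \big[op/idx]_(j.+1 <= b < n.+1) f (p - 2 * b)%N.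
Proof.
move=> jn; rewrite big_nat_rev_shift //.
apply: eq_big_nat => a /andP[_ an]; congr f.
by have := p_half; lia.
Qed.

Local Notation T := (\sum_(1 <= k < n.+1) k%:R^-1 ^+ 2 : rat).

Lemma le_half_unit k : (1 <= k < n.+1)%N ->
  (k%:R : rat) != 0 /\ (k%:R^-1 : rat) \in Zloc p.
Proof. by move=> h; apply: lt_p_unit; have := p_half; lia. Qed.

(** The sum of all 1/k^2 with k < p is 2T when it is split at p/2, since
    k -> p - k preserves squares, and T/2 when it is split by parity, since the
    even and the odd parts agree and the even one is T/4. *)
Lemma harm2_eq0 : T = 0 %[p^ 1].
Proof.
pose f k : rat := k%:R^-1 ^+ 2.
have hf k : (0 < k < p)%N -> f (p - k)%N = f k %[p^ 1].
  move=> kp; rewrite /f -(sqrrN k%:R^-1) !expr2.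
  have [k0 zk] := lt_p_unit kp.
  have /lt_p_unit[j0 zj] : (0 < p - k < p)%N by lia.
  by apply: eqmM; [zloc | zloc | apply: inv_psub1 | apply: inv_psub1].
have even : \sum_(1 <= b < n.+1) f (2 * b)%N = T / 4.
  rewrite mulr_suml; apply: eq_bigr => b _; rewrite /f natrM invfM.
  by move: _%:R^-1 => t; field.
have e1 : \sum_(1 <= k < (2 * n).+1) f k = T / 2 %[p^ 1].
  rewrite big_nat_odd_even /=.
  have -> : ((2 * n)./2 = n - 0)%N by lia.
  have -> : (2 * n - (n - 0) = n - 0)%N by lia.
  rewrite odd_reflect // subn0 even.
  have -> : T / 2 = T / 4 + T / 4 by field.
  apply: eqmD; last exact: eqm_refl.
  by rewrite -even; apply: eqm_sum => b hb; apply: hf; have := p_half; lia.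
have e2 : \sum_(1 <= k < (2 * n).+1) f k = T + T %[p^ 1].
  rewrite (big_cat_nat (n := n.+1)) //=; last by lia.
  apply: eqmD; first exact: eqm_refl.
  rewrite big_nat_rev_shift; last by lia.
  have -> : (2 * n - n = n)%N by lia.
  rewrite -(big_add1 _ _ 0 n.+1 xpredT (fun a => f (2 * n - a.-1)%N)).
  apply: eqm_sum => k hk.
  have -> : (2 * n - k.-1 = p - k)%N by have := p_half; lia.
  by apply: hf; have := p_half; lia.
have : 2 / 3 * (T + T - T / 2) = 2 / 3 * (T / 2 - T / 2) %[p^ 1].
  apply: eqmMl; first by zloc.
  by apply: eqmB; [exact: eqm_trans (eqm_sym e2) e1 | apply: eqm_refl].
have -> : 2 / 3 * (T + T - T / 2) = T by field.
by rewrite subrr mulr0.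
Qed.

Lemma oddharm_half : oddharm n = - harm n / 2 %[p^ 2].
Proof.
rewrite /oddharm -[X in \sum_(0 <= _ < X) _]subn0.
rewrite (odd_reflect _ (fun k => k%:R^-1)) //.
have hT : P * T = 0 %[p^ 2].
  rewrite -[X in _ = X %[p^ _]](mulr0 P); apply: (@eqmMp 1 1) harm2_eq0.
  by apply/eqm0P; exists 1; rewrite ?rpred1 // mulr1.
apply: (@eqm_trans _ _ (- harm n / 2 - 4^-1 * (P * T))); last first.
  rewrite -[X in _ = X %[p^ _]]subr0 -[X in _ = _ - X %[p^ _]](mulr0 4^-1).
  apply: eqmB; first exact: eqm_refl.
  by apply: eqmMl => //; apply: Zloc_inv4.
rewrite (mulrC 4^-1).
have -> : - harm n / 2 - P * T / 4 = \sum_(1 <= b < n.+1)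
    (- (2 * b)%:R^-1 - P / (2 * b)%:R ^+ 2).
  rewrite /harm mulr_sumr !(mulr_suml, sumrN) -sumrN mulr_suml -sumrB.
  apply: eq_bigr => b _; rewrite natrM -exprVn invfM.
  by move: b%:R^-1 => t; field.
apply: eqm_sum => b hb; apply: inv_psub.
by have := p_half; lia.
Qed.

(** * The double harmonic sum *)

Lemma mixharm_pairs K J : (K <= J)%N ->
  mixharm K = \sum_(0 <= a < J) \sum_(a.+1 <= b < K.+1)
                (2 * a + 1)%:R^-1 / b%:R.
Proof.
move=> KJ; rewrite -(exchange_big_triangle _ (fun a b => _ / _)) //.
by apply: eq_bigr => b _; rewrite /oddharm mulr_suml.
Qed.

(** Let A be the sum of 1/(js) over odd j < even s < p, half of the sum in
    question.  Put s = j + d with d odd.  Symmetrizing in j and d, and using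
    1/(j(j+d)) + 1/(d(j+d)) = 1/(jd), gives 2A as the sum of 1/(jd) over odd
    j, d with j + d < p.  The reflection d -> p - d turns the latter into -A
    modulo p, whence 3A = 0. *)
Lemma mixharm_half_eq0 : mixharm n = 0 %[p^ 1].
Proof.
have unit_odd a : ((2 * a + 1)%:R : rat) != 0 by rewrite pnatr_eq0 addn1.
have e : mixharm n = \sum_(0 <= a < n) \sum_(a.+1 <= b < n.+1)
    (2 * a + 1)%:R^-1 / (p - 2 * b)%:R.
  (* j = 2a+1, s = 2b and d = 2(b-1-a)+1; for fixed a, reversing the order of
     the b's turns d into p - 2b. *)
  transitivity (\sum_(0 <= a < n) \sum_(a.+1 <= b < n.+1)
      (2 * a + 1)%:R^-1 / (2 * (b - 1 - a) + 1)%:R : rat); last first.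
    apply: eq_big_nat => a /andP[_ an]; rewrite big_nat_rev /=.
    apply: eq_big_nat => b /andP[ab bn]; congr (_ / _%:R).
    by have := p_half; lia.
  rewrite -(exchange_big_triangle _ (fun a b => _ / _)) //.
  apply: eq_big_nat => b /andP[b0 _].
  have b0' : (b%:R : rat) != 0 by rewrite pnatr_eq0 -lt0n.
  apply: (mulfI (x := 2)) => //; rewrite [LHS]mulrDl mul1r.
  rewrite {1}/oddharm big_nat_rev /= /oddharm !mulr_suml -big_split mulr_sumr.
  apply: eq_big_nat => a /andP[_ ab] /=.
  have -> : (2 * (0 + b - a.+1) + 1 = 2 * (b - 1 - a) + 1)%N by lia.
  have e : b%:R = ((2 * a + 1)%:R + (2 * (b - 1 - a) + 1)%:R) / 2 :> rat.
    by rewrite -natrD; apply: (mulIf (x := 2)) => //; rewrite divfK // -natrM;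
       congr _%:R; lia.
  have := unit_odd a; have := unit_odd (b - 1 - a)%N; move: b0'; rewrite e.
  move: _%:R => u; move: _%:R => v w0 u0 v0; field.
  by rewrite u0 v0; apply: contraNneq w0 => ->; rewrite mul0r.
have h : mixharm n = - 2^-1 * mixharm n %[p^ 1].
  rewrite {1}e (mixharm_pairs (leqnn n)) mulr_sumr.
  apply: eqm_sum => a /andP[_ an]; rewrite mulr_sumr.
  apply: eqm_sum => b /andP[ab bn].
  have -> : - 2^-1 * ((2 * a + 1)%:R^-1 / b%:R)
      = (2 * a + 1)%:R^-1 * - (2 * b)%:R^-1 :> rat by rewrite natrM invfM; ring.
  apply: eqmMl; last by apply: inv_psub1; have := p_half; lia.
  by apply: (lt_p_unit _).2; have := p_half; lia.
have : 2 / 3 * (mixharm n - - 2^-1 * mixharm n)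
     = 2 / 3 * (- 2^-1 * mixharm n - - 2^-1 * mixharm n) %[p^ 1].
  apply: eqmMl; first by zloc.
  by apply: eqmB h (eqm_refl _ _).
have -> : 2 / 3 * (mixharm n - - 2^-1 * mixharm n) = mixharm n by field.
by rewrite subrr mulr0.
Qed.

Lemma oddharm_upper :
  oddharm (n - m) = - (harm n - harm m) / 2 %[p^ 1].
Proof.
rewrite /oddharm (odd_reflect _ (fun k => k%:R^-1)) ?half_half_le //.
have -> : - (harm n - harm m) / 2 = \sum_(m.+1 <= b < n.+1) - (2 * b)%:R^-1.
  rewrite /harm (big_cat_nat (n := m.+1)) //= ?ltnS ?half_half_le //.
  rewrite [X in X - _]addrC addrK -sumrN mulr_suml; apply: eq_bigr => b _.
  by rewrite natrM invfM mulrC mulrN.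
by apply: eqm_sum => b hb; apply: inv_psub1; have := p_half; lia.
Qed.

Lemma Zloc_oddharm K : (K <= n)%N -> oddharm K \in Zloc p.
Proof.
move=> Kn; rewrite /oddharm big_nat; apply: rpred_sum => a ha.
by apply: (lt_p_unit _).2; have := p_half; lia.
Qed.

(** The pairs odd j < even s below p split according to p/2.  The pairs above
    p/2 are the reflections (p-s, p-j) of those below, so both kinds have the
    same sum.  For j below and s above, the condition j < s is automatic and the
    sum is a product of two single sums, which are opposite by reflection.  The
    total vanishes by [mixharm_half_eq0]. *)
Lemma mixharm_quarter : mixharm m = oddharm (n - m) ^+ 2 %[p^ 1].
Proof.
set O := oddharm (n - m).
have mn := half_half_le.
have zO : O \in Zloc p by apply: Zloc_oddharm; lia.
have upper : \sum_(m.+1 <= b < n.+1) b%:R^-1 = - 2 * O %[p^ 1].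
  rewrite /O /oddharm (odd_reflect _ (fun k => k%:R^-1)) // mulr_sumr.
  apply: eqm_sum => b hb; apply: eqm_sym.
  have -> : b%:R^-1 = - 2 * - (2 * b)%:R^-1 :> rat.
    by rewrite natrM invfM; move: b%:R^-1 => t; field.
  apply: eqmMl; first by zloc.
  by apply: inv_psub1; have := p_half; lia.
have high : \sum_(m.+1 <= b < n.+1) \sum_(n - m <= a < b)
    (2 * a + 1)%:R^-1 / b%:R = mixharm m %[p^ 1].
  (* a = n - d and b = n - c, so that 2a+1 = p - 2d and 2b = p - (2c+1). *)
  rewrite (@mixharm_pairs m (n - m)); last by lia.
  rewrite big_nat_rev_shift //; apply: eqm_sum => c hc.
  rewrite big_nat_rev_sub; last by lia.
  apply: eqm_sum => d hd.
  have nd : (0 < 2 * d < p)%N by have := p_half; lia.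
  have nc : (0 < 2 * c + 1 < p)%N by have := p_half; lia.
  have -> : (2 * (n - d) + 1 = p - 2 * d)%N by have := p_half; lia.
  have -> : (n - c)%:R^-1 = 2 * (p - (2 * c + 1))%:R^-1 :> rat.
    have -> : (p - (2 * c + 1) = 2 * (n - c))%N by have := p_half; lia.
    by rewrite natrM invfM; move: _%:R^-1 => t; field.
  have -> : (2 * c + 1)%:R^-1 / d%:R
      = (- (2 * d)%:R^-1) * (2 * - (2 * c + 1)%:R^-1) :> rat.
    by rewrite natrM invfM; move: d%:R^-1 => t; move: (_ + 1)%:R^-1 => u; field.
  have [_ z1] := lt_p_unit nd; have [_ z2] := lt_p_unit nc.
  have zc' : (p - (2 * c + 1))%:R^-1 \in Zloc p.
    by apply: (lt_p_unit _).2; lia.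
  apply: eqmM; [by zloc | by zloc | exact: inv_psub1 |].
  by apply: eqmMl; [zloc | exact: inv_psub1].
have split : mixharm n = mixharm m + (- 2 * O * O + mixharm m) %[p^ 1].
  rewrite {1}/mixharm (big_cat_nat (n := m.+1)) //= ?ltnS //.
  apply: eqmD; first exact: eqm_refl.
  apply: eqm_trans (eqmD (eqmM zO _ upper (eqm_refl _ O)) high); last by zloc.
  rewrite mulr_suml -big_split /=.
  have -> : \sum_(m.+1 <= b < n.+1) oddharm b / b%:R =
     \sum_(m.+1 <= b < n.+1) (b%:R^-1 * O +
        \sum_(n - m <= a < b) (2 * a + 1)%:R^-1 / b%:R).
    apply: eq_big_nat => b hb; rewrite -mulr_suml (mulrC _ O) -mulrDl.
    by congr (_ / _); rewrite /O /oddharm -big_cat_nat //=; lia.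
  exact: eqm_refl.
have h := eqm_trans (eqm_sym split) mixharm_half_eq0.
have := eqmD (eqmMl Zloc_inv2 h) (eqm_refl 1 (O ^+ 2)).
have -> : 2^-1 * (mixharm m + (-2 * O * O + mixharm m)) + O ^+ 2 = mixharm m.
  by field.
by rewrite mulr0 add0r.
Qed.

(** * Truncated logarithms of products *)

Local Notation h := (P * harm n).
Local Notation z :=
  (\sum_(1 <= r < m.+1) (P / (2 * r)%:R + (P / (2 * r)%:R) ^+ 2 / 2)).
Local Notation O := (oddharm (n - m)).

Lemma Zloc_harm K : (K <= n)%N -> harm K \in Zloc p.
Proof.
move=> Kn; rewrite /harm big_nat; apply: rpred_sum => a ha.
by apply: (le_half_unit _).2; lia.
Qed.

Lemma eqm_scale_p k x y : x = y %[p^ k] -> P * x = P * y %[p^ k.+1].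
Proof.
by apply: (@eqmMp 1 k); apply/eqm0P; exists 1; rewrite ?rpred1 // mulr1.
Qed.

Lemma harm2_scaled (c : rat) : c \in Zloc p ->
  c * (P ^+ 2 * T) = 0 %[p^ 3].
Proof.
move=> zc; have := eqmMl zc (eqm_scale_p (eqm_scale_p harm2_eq0)).
by rewrite !mulr0 [P * (P * _)]mulrA -expr2.
Qed.

Lemma eqm_quad x y : x \in Zloc p -> y \in Zloc p -> x = y %[p^ 3] ->
  1 - x + x ^+ 2 / 2 = 1 - y + y ^+ 2 / 2 %[p^ 3].
Proof.
move=> zx zy [s zs e]; exists (s * (-1 + (x + y) / 2)); first by zloc.
by rewrite mulrA -e; field.
Qed.

Lemma divp_eq0 k : (1 <= k < n.+1)%N ->
  P / k%:R = 0 %[p^ 1] /\ P / (2 * k)%:R = 0 %[p^ 1].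
Proof.
move=> hk; have [_ zk] := le_half_unit hk.
have [_ zk2] : ((2 * k)%:R : rat) != 0 /\ (2 * k)%:R^-1 \in Zloc p.
  by apply: lt_p_unit; have := p_half; lia.
split; apply/eqm0P; first by exists k%:R^-1.
by exists (2 * k)%:R^-1.
Qed.

Lemma harm_prod : \prod_(1 <= k < n.+1) (1 - P / k%:R)
  = 1 - h + h ^+ 2 / 2 %[p^ 3].
Proof.
have zH := Zloc_harm (leqnn n); have zP := Zloc_p.
have [|Z1 e] := @prod_log n (fun k => P / k%:R).
  by move=> k /divp_eq0[].
apply: (eqm_trans e); apply: eqm_quad; [|by zloc|].
  by apply: eqm_Zloc Z1 (rpred0 _).
have -> : \sum_(1 <= k < n.+1) (P / k%:R + (P / k%:R) ^+ 2 / 2)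
    = h + 2^-1 * (P ^+ 2 * T).
  rewrite /harm !mulr_sumr -big_split; apply: eq_bigr => k _ /=.
  by move: k%:R^-1 => t; field.
rewrite -[X in _ = X %[p^ _]]addr0; apply: eqmD; first exact: eqm_refl.
by apply: harm2_scaled; zloc.
Qed.

Lemma harm_prod2 : \prod_(1 <= k < n.+1) (1 - P / (2 * k)%:R)
  = 1 - h / 2 + (h / 2) ^+ 2 / 2 %[p^ 3].
Proof.
have zH := Zloc_harm (leqnn n); have zP := Zloc_p.
have [|Z1 e] := @prod_log n (fun k => P / (2 * k)%:R).
  by move=> k /divp_eq0[].
apply: (eqm_trans e); apply: eqm_quad; [|by zloc|].
  by apply: eqm_Zloc Z1 (rpred0 _).
have -> : \sum_(1 <= k < n.+1) (P / (2 * k)%:R + (P / (2 * k)%:R) ^+ 2 / 2)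
    = h / 2 + 2^-1 ^+ 3 * (P ^+ 2 * T).
  rewrite /harm !mulr_sumr mulr_suml -big_split; apply: eq_bigr => k _ /=.
  by rewrite natrM invfM; move: k%:R^-1 => t; field.
rewrite -[X in _ = X %[p^ _]]addr0; apply: eqmD; first exact: eqm_refl.
by apply: harm2_scaled; zloc.
Qed.

(** The quotient of [harm_prod] by [harm_prod2], by [prod_half_index]. *)
Lemma two_pow_eq : 2 ^+ (p - 1) = 1 - h / 2 + (h / 2) ^+ 2 / 2 %[p^ 3].
Proof.
set E := 2 ^+ (p - 1).
have zE : E \in Zloc p by rewrite rpredX // rpred_nat.
have zH := Zloc_harm (leqnn n); have zP := Zloc_p.
have := prod_half_index n; rewrite -p_half.
have -> : 4 ^+ n = E :> rat.
  by rewrite /E {2}p_half subn1 /= exprM.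
move: harm_prod harm_prod2; set M := \prod_(_ <= _ < _) _.
set N := \prod_(_ <= _ < _) _ => hM [s zs hN] eM.
have eN : N = 1 + P * (- harm n / 2 + (P * harm n ^+ 2) / 2 / 4 + P ^+ 2 * s).
  by rewrite -[N](subrK (1 - h / 2 + (h / 2) ^+ 2 / 2)) hN; field.
have [|N0 zN] := @Zloc_1p_inv
    (- harm n / 2 + (P * harm n ^+ 2) / 2 / 4 + P ^+ 2 * s); first by zloc.
rewrite -eN in N0 zN.
apply: (eqmIl N0 zN); rewrite mulrC -eM.
apply: (eqm_trans hM).
exists (- (1 - h / 2 + (h / 2) ^+ 2 / 2) * s
        + harm n ^+ 3 * (2^-1 ^+ 3) - P * harm n ^+ 4 * 2^-1 ^+ 6).
  by zloc.
by rewrite eN; field.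
Qed.

(** Let W and V be the products of the 1 - p/(2b) over b <= m and over
    m < b <= n.  The last product is W V.  In the product of the 1 - p/k, the
    even k contribute W, and the odd k contribute 1/V, because 1 - p/k and
    1 - p/(p-k) are inverse to each other. *)
Lemma quarter_prod_sqr :
  \prod_(1 <= r < m.+1) (1 - P / (2 * r)%:R) ^+ 2 =
  \prod_(1 <= k < n.+1) (1 - P / k%:R) *
  \prod_(1 <= k < n.+1) (1 - P / (2 * k)%:R).
Proof.
rewrite prodrXl [X in _ = X * _]big_nat_odd_even /=.
rewrite (odd_reflect _ (fun k => 1 - P / k%:R)) ?half_half_le //.
rewrite [X in _ = _ * X](big_cat_nat (n := m.+1)) //= ?ltnS ?half_half_le //.
have -> : \prod_(m.+1 <= b < n.+1) (1 - P / (p - 2 * b)%:R) =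
   (\prod_(m.+1 <= b < n.+1) (1 - P / (2 * b)%:R))^-1.
  rewrite -prodfV; apply: eq_big_nat => b hb.
  have b2p : (2 * b < p)%N by have := p_half; lia.
  have b0 : ((2 * b)%:R : rat) != 0 by rewrite pnatr_eq0; lia.
  have c0 : ((p - 2 * b)%:R : rat) != 0 by rewrite pnatr_eq0; lia.
  have e : (p - 2 * b)%:R = P - (2 * b)%:R by rewrite natrB // ltnW.
  rewrite e in c0 *; move: b0 c0; move: (2 * b)%:R => c b0 c0; field.
  by rewrite b0 c0 -opprB oppr_eq0 c0.
set V := \prod_(m.+1 <= _ < _) _; set W := \prod_(_ <= _ < _) _.
have V0 : V != 0.
  rewrite /V prodf_seq_neq0; apply/allP => b; rewrite mem_index_iota => hb /=.
  have b2p : (2 * b != p)%N by have := p_half; lia.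
  have b0 : ((2 * b)%:R : rat) != 0 by rewrite pnatr_eq0; lia.
  by rewrite subr_eq0 -(inj_eq (mulIf b0)) mul1r divfK // eqr_nat.
by field.
Qed.

(** The logarithm of [quarter_prod_sqr]: 2z = h + h/2. *)
Lemma quarter_log : z = 3 / 4 * h %[p^ 3].
Proof.
have zH := Zloc_harm (leqnn n); have zP := Zloc_p.
have [|] := @prod_log m (fun k => P / (2 * k)%:R).
  by move=> k hk; apply: (divp_eq0 _).2; have := half_half_le; lia.
move: quarter_prod_sqr harm_prod harm_prod2; rewrite prodrXl.
set W := \prod_(1 <= _ < m.+1) _; set M := \prod_(_ <= _ < _) _.
set N := \prod_(_ <= _ < _) _.
move=> eW hM hN /eqm0P[w zw ez] hW; rewrite ez in hW *.
have zW := eqm_Zloc hW; have zN := eqm_Zloc hN; have zM := eqm_Zloc hM.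
have h1 : W * W = (1 - P ^+ 1 * w + (P ^+ 1 * w) ^+ 2 / 2) *
    (1 - P ^+ 1 * w + (P ^+ 1 * w) ^+ 2 / 2) %[p^ 3].
  by apply: eqmM => //; [apply: zW; zloc | zloc].
have h2 : M * N = (1 - h + h ^+ 2 / 2) *
    (1 - h / 2 + (h / 2) ^+ 2 / 2) %[p^ 3].
  by apply: eqmM => //; [apply: zN; zloc | zloc].
rewrite -expr2 eW in h1; have [s zs e] := eqm_trans (eqm_sym h1) h2.
set H := harm n in zH e *.
(* The two quadratic expansions differ by z - 3h/4 times
   -2 + 2(z + 3h/4), up to cubic terms. *)
have : P ^+ 1 * w - 3 / 4 * (P * H)
     = P * (w + 3 / 4 * H) * (P ^+ 1 * w - 3 / 4 * (P * H)) %[p^ 3].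
  exists (- 2^-1 * (s + w ^+ 3 - P * w ^+ 4 / 4 - 3 / 2 / 4 * H ^+ 3
      + P * H ^+ 4 / 4 / 4)); first by zloc.
  transitivity (- 2^-1 * (P ^+ 3 * s + P ^+ 3 * (w ^+ 3 - P * w ^+ 4 / 4
    - 3 / 2 / 4 * H ^+ 3 + P * H ^+ 4 / 4 / 4))); last by field.
  by rewrite -e; field.
move=> /eqm_selfmul h3; have /h3/eqm0P[t zt e'] : w + 3 / 4 * H \in Zloc p.
  by zloc.
by exists t.
Qed.

Lemma oddharm_quarter : P * O = h / 4 %[p^ 2].
Proof.
have mn := half_half_le; have zP := Zloc_p.
have zH := Zloc_harm (leqnn n); have zHm := Zloc_harm mn.
have ez : z = P * harm m / 2 %[p^ 2].
  rewrite /harm mulr_sumr mulr_suml; apply: eqm_sum => r hr.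
  have [_ zr] : (r%:R : rat) != 0 /\ r%:R^-1 \in Zloc p.
    by apply: le_half_unit; lia.
  exists ((r%:R^-1) ^+ 2 * 2^-1 ^+ 3); first by zloc.
  by rewrite natrM invfM; move: r%:R^-1 => t; field.
have eO : P * O = P * (- (harm n - harm m) / 2) %[p^ 2].
  exact: eqm_scale_p oddharm_upper.
apply: (eqm_trans eO).
have -> : P * (- (harm n - harm m) / 2) = P * harm m / 2 - h / 2 by field.
have -> : h / 4 = 3 / 4 * h - h / 2 by field.
apply: eqmB; last exact: eqm_refl.
exact: eqm_trans (eqm_sym ez) (eqm_weaken (leqnSn 2) quarter_log).
Qed.

(** * Expansion at -p/4 and walk to the target *)

Local Notation x := (- P / 4 : rat).

Lemma base_unit k : (1 <= k < n.+1)%N ->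
  x - k%:R != 0 /\ (x - k%:R)^-1 \in Zloc p.
Proof.
move=> hk; have pk : ~~ (p %| 4 * k + p)%N.
  rewrite dvdn_addl // Euclid_dvdM // negb_or !gtnNdvd //; have := p_half; lia.
have c0 : ((4 * k + p)%:R : rat) != 0 by rewrite pnatr_eq0; lia.
have e : x - k%:R = - (4 * k + p)%:R / 4 by rewrite natrD natrM; field.
have zc := Zloc_nat_inv pk.
rewrite e invfM invrN invrK mulf_neq0 ?oppr_eq0 //; split=> //; by zloc.
Qed.

Lemma walk_unit r : (1 <= r < m.+1)%N ->
  x + r%:R != 0 /\ (x + r%:R)^-1 \in Zloc p.
Proof.
move=> hr; have [c0 zc] : ((p - 4 * r)%:R : rat) != 0 /\
    ((p - 4 * r)%:R^-1 : rat) \in Zloc p.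
  by apply: lt_p_unit; have := p_half; lia.
have e : x + r%:R = - (p - 4 * r)%:R / 4.
  by rewrite natrB ?natrM; [field | have := p_half; lia].
rewrite e invfM invrN invrK mulf_neq0 ?oppr_eq0 //; split=> //; by zloc.
Qed.

Lemma half_natr : n%:R = (P - 1) / 2 :> rat.
Proof. by rewrite {2}p_half -natr1 natrM; field. Qed.

Lemma step_unit i : (i < m)%N ->
  x + i%:R - n%:R != 0 /\ (x + i%:R - n%:R)^-1 \in Zloc p.
Proof.
move=> hi; have [c0 zc] : ((4 * i + 2)%:R : rat) != 0 /\
    ((4 * i + 2)%:R^-1 : rat) \in Zloc p.
  by apply: lt_p_unit; have := p_half; lia.
have z3 : - 3 \in Zloc p by zloc.
have [d0 zd] := Zloc_thick_inv (rpred_nat _ (4 * i + 2)) c0 zc z3.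
have e : x + i%:R - n%:R = ((4 * i + 2)%:R + P * - 3) / 4.
  by rewrite half_natr natrD natrM; field.
rewrite e invfM invrK mulf_neq0 //; split=> //; by zloc.
Qed.

Lemma sinprod_base K : (K <= n)%N -> sinprod K x =
  1 - 4^-1 ^+ 2 * (P ^+ 2 * \sum_(1 <= k < K.+1) k%:R^-1 ^+ 2) %[p^ 3].
Proof.
move=> Kn; have zP := Zloc_p.
set TK := \sum_(_ <= _ < _) _.
have zT : TK \in Zloc p.
  rewrite /TK big_nat; apply: rpred_sum => k hk.
  by rewrite rpredX // (le_half_unit _).2 //; lia.
have [|Z1 e] := @prod_log K (fun k => x ^+ 2 / k%:R ^+ 2).
  move=> k hk; have [_ zk] : (k%:R : rat) != 0 /\ k%:R^-1 \in Zloc p.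
    by apply: le_half_unit; lia.
  apply/eqm0P; exists (P * 4^-1 ^+ 2 * k%:R^-1 ^+ 2); first by zloc.
  by move: k%:R => t; rewrite -exprVn; move: (t^-1) => u; field.
apply: (eqm_trans e); apply: (eqm_trans (eqm_quad _ _ _)).
- exact: eqm_Zloc Z1 (rpred0 _).
- by have : 4^-1 ^+ 2 * (P ^+ 2 * TK) \in Zloc p; [zloc | apply].
- rewrite /TK !mulr_sumr; apply: eqm_sum => k hk.
  have [_ zk] : (k%:R : rat) != 0 /\ k%:R^-1 \in Zloc p.
    by apply: le_half_unit; lia.
  exists (P * 4^-1 ^+ 4 * k%:R^-1 ^+ 4 / 2); first by zloc.
  by move: k%:R => t; rewrite -exprVn; move: (t^-1) => u; field.
exists (P * (4^-1 ^+ 2 * TK) ^+ 2 / 2); first by zloc.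
by field.
Qed.

Lemma sinprod_base1 K : (K <= n)%N -> sinprod K x = 1 %[p^ 2].
Proof.
move=> Kn; apply: (eqm_trans (eqm_weaken (leqnSn 2) (sinprod_base Kn))).
set TK := \sum_(_ <= _ < _) _.
have zT : TK \in Zloc p.
  rewrite /TK big_nat; apply: rpred_sum => k hk.
  by rewrite rpredX // (le_half_unit _).2 //; lia.
by exists (- 4^-1 ^+ 2 * TK); [zloc | field].
Qed.

Lemma sinprod_base_half : sinprod n x = 1 %[p^ 3].
Proof.
apply: (eqm_trans (sinprod_base (leqnn n))).
rewrite -[X in _ = X %[p^ _]]subr0; apply: eqmB; first exact: eqm_refl.
by apply: harm2_scaled; zloc.
Qed.

(** For k < n the summand of (2x+1) S_n(x) is x/(x-k) + 2x/(2k+1), by partial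
    fractions: x is divisible by p, so [sinprod] counts only modulo p^2.  For
    k = n the denominator 2n+1 = p cancels the factor p of x, and [sinprod] is
    needed modulo p^3. *)
Lemma hypS_base : (2 * x + 1) * hypS n x = (1 + h) / 2 %[p^ 3].
Proof.
have zP := Zloc_p.
have n0 : (0 < n)%N by have := p_half; lia.
have hc k : (1 <= k < n.+1)%N -> hypc x k = x / (x - k%:R) * sinprod k x.
  move=> /base_unit[d0 _]; apply: (mulfI d0).
  by rewrite hypc_eq_sinprod mulrA (mulrC _ (x / _)) divfK.
have mid : \sum_(1 <= k < n) (2 * x + 1) * (hypc x k / (2 * k + 1)%:R) =
    \sum_(1 <= k < n) (x / (x - k%:R) + 2 * x / (2 * k + 1)%:R) %[p^ 3].
  apply: eqm_sum => k hk; have hk' : (1 <= k < n.+1)%N by lia.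
  have [d0 zd] := base_unit hk'.
  have [u0 zu] : ((2 * k + 1)%:R : rat) != 0 /\ (2 * k + 1)%:R^-1 \in Zloc p.
    by apply: lt_p_unit; have := p_half; lia.
  rewrite hc //.
  have -> : x / (x - k%:R) + 2 * x / (2 * k + 1)%:R
     = P * (- 4^-1 * (2 * x + 1) / (x - k%:R) / (2 * k + 1)%:R * 1).
    rewrite natrD natrM in u0 *; move: d0 u0; move: k%:R => t d0 u0.
    field; rewrite u0 /=; apply: contraNneq d0 => e; apply/eqP.
    by rewrite -(mulr0 (4^-1)) -e; field.
  have -> : (2 * x + 1) * (x / (x - k%:R) * sinprod k x / (2 * k + 1)%:R)
     = P * (- 4^-1 * (2 * x + 1) / (x - k%:R) / (2 * k + 1)%:R * sinprod k x).
    by move: (x - _)^-1 (_ + 1)%:R^-1 => a b; field.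
  apply: eqm_scale_p; apply: eqmMl; first by zloc.
  by apply: sinprod_base1; lia.
have hn : (1 <= n < n.+1)%N by lia.
have [d0 zd] := base_unit hn.
have last : (2 * x + 1) * (hypc x n / (2 * n + 1)%:R) =
    - 4^-1 * (2 * x + 1) / (x - n%:R) * 1 %[p^ 3].
  rewrite hc // addn1 -p_half.
  have P0 : P != 0 by rewrite pnatr_eq0; lia.
  have -> : (2 * x + 1) * (x / (x - n%:R) * sinprod n x / P) =
     - 4^-1 * (2 * x + 1) / (x - n%:R) * sinprod n x.
    by move: (x - _)^-1 => a; field.
  by apply: eqmMl; [zloc | exact: sinprod_base_half].
have first : (2 * x + 1) * (hypc x 0 / (2 * 0 + 1)%:R) = 2 * x + 1.
  by rewrite /hypc big_nil muln0 add0n !mul1r invr1 mulr1.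
(* The geometric expansion of x/(x-k) in x/k; its quadratic terms sum to a
   multiple of p^2 T. *)
have geo : \sum_(1 <= k < n.+1) x / (x - k%:R) = h / 4 %[p^ 3].
  have -> : h / 4 = \sum_(1 <= k < n.+1) P / 4 / k%:R.
    by rewrite -mulr_sumr /harm; field.
  apply: (@eqm_trans _ _ (\sum_(1 <= k < n.+1) P / 4 / k%:R
     - 4^-1 ^+ 2 * (P ^+ 2 * T))); last first.
    rewrite -[X in _ = X %[p^ _]]subr0; apply: eqmB; first exact: eqm_refl.
    by apply: harm2_scaled; zloc.
  rewrite 2!mulr_sumr -sumrB; apply: eqm_sum => k hk.
  have [k0 zk] := le_half_unit hk; have [e0 ze] := base_unit hk.
  exists (- 4^-1 ^+ 3 * k%:R^-1 ^+ 2 / (x - k%:R)); first by zloc.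
  move: e0 k0; move: k%:R => t e0 k0; field; rewrite k0 andbT.
  by apply: contraNneq e0 => e; rewrite -(mulr0 (4^-1)) -e; apply/eqP; field.
have odd : 2 * x * oddharm n = h / 4 %[p^ 3].
  have -> : 2 * x * oddharm n = P * (- 2^-1 * oddharm n) by field.
  have -> : h / 4 = P * (- 2^-1 * (- harm n / 2)) by field.
  by apply: eqm_scale_p; apply: eqmMl oddharm_half; zloc.
have -> : (2 * x + 1) * hypS n x = 2 * x + 1
   + \sum_(1 <= k < n) (2 * x + 1) * (hypc x k / (2 * k + 1)%:R)
   + (2 * x + 1) * (hypc x n / (2 * n + 1)%:R).
  by rewrite /hypS mulr_sumr big_nat_recr //= big_ltn // first.
apply: (eqm_trans (eqmD (eqmD (eqm_refl _ _) mid) last)).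
have -> : 2 * x + 1 + \sum_(1 <= k < n) (x / (x - k%:R) + 2 * x / (2 * k + 1)%:R)
     + - 4^-1 * (2 * x + 1) / (x - n%:R) * 1
   = 1 / 2 + \sum_(1 <= k < n.+1) x / (x - k%:R) + 2 * x * oddharm n.
  have -> : 2 * x * oddharm n
      = 2 * x + \sum_(1 <= k < n) 2 * x / (2 * k + 1)%:R.
    by rewrite /oddharm big_ltn // muln0 add0n invr1 mulrDr mulr1 mulr_sumr.
  have -> : \sum_(1 <= k < n.+1) x / (x - k%:R)
      = \sum_(1 <= k < n) x / (x - k%:R) + x / (x - n%:R).
    by rewrite big_nat_recr.
  have -> : \sum_(1 <= k < n) (x / (x - k%:R) + 2 * x / (2 * k + 1)%:R)
      = \sum_(1 <= k < n) x / (x - k%:R)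
        + \sum_(1 <= k < n) 2 * x / (2 * k + 1)%:R by exact: big_split.
  move: (\sum_(1 <= k < n) _) (\sum_(1 <= k < n) _) => A B.
  rewrite half_natr in d0 *; field.
  by apply: contraNneq d0 => e; rewrite -(mulr0 (8^-1)) -e; apply/eqP; field.
have -> : (1 + h) / 2 = 1 / 2 + h / 4 + h / 4 by field.
by apply: eqmD odd; apply: eqmD geo; apply: eqm_refl.
Qed.

Lemma step_prod r : (r <= m)%N ->
  \prod_(0 <= i < r) ((x + i%:R + n%:R + 1) / (x + i%:R - n%:R))
  = 1 + 2 * P * oddharm r %[p^ 2].
Proof.
have zP := Zloc_p; have mn := half_half_le.
elim: r => [|r IH] hr.
  by rewrite /oddharm !big_nil mulr0 addr0; apply: eqm_refl.
have [s zs /eqP] := IH (ltnW hr); rewrite subr_eq => /eqP e.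
rewrite big_nat_recr //= e /oddharm big_nat_recr //= -/(oddharm r).
have zO : oddharm r \in Zloc p by apply: Zloc_oddharm; lia.
have [d0 zd] := step_unit hr.
have [u0 zu] : ((2 * r + 1)%:R : rat) != 0 /\ (2 * r + 1)%:R^-1 \in Zloc p.
  by apply: lt_p_unit; have := p_half; lia.
have zx : x \in Zloc p by zloc.
have e1 : (x + r%:R + n%:R + 1) / (x + r%:R - n%:R) =
  1 + 2 * P / (2 * r + 1)%:R
   + P ^+ 2 * (3 / ((2 * r + 1)%:R * (x + r%:R - n%:R)) * 2^-1).
  rewrite natrD natrM half_natr in u0 d0 *.
  move: u0 d0; move: r%:R => t u0 d0; field; rewrite u0 andbT.
  by apply: contraNneq d0 => e'; rewrite -(mulr0 (8^-1)) -e'; apply/eqP; field.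
rewrite e1 invfM; move: (x + _ - _)^-1 (_ + 1)%:R^-1 zd zu => a b za zb.
exists (s * (1 + 2 * P * b + P ^+ 2 * (3 * (b * a) * 2^-1))
   + (1 + 2 * P * oddharm r) * (3 * (b * a) * 2^-1) + 4 * oddharm r * b).
  by zloc.
by field.
Qed.

(** The factor 2x/(x+r) of the r-th difference is -(y + y^2/2) with y = p/(2r),
    whose sum is -z; the correction 2p(1 + 1/3 + ...) of the other factor meets
    2x/r = -p/(2r). *)
Lemma sinprod_walk_sum : \sum_(1 <= r < m.+1) 2 * sinprod n (x + r%:R)
  = - z - P ^+ 2 * mixharm m %[p^ 3].
Proof.
have zP := Zloc_p; have mn := half_half_le.
rewrite /mixharm mulr_sumr -sumrN -sumrB; apply: eqm_sum => r hr.
have [d0 zd] := walk_unit hr.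
have [r0 zr] : (r%:R : rat) != 0 /\ r%:R^-1 \in Zloc p.
  by apply: le_half_unit; lia.
have zO : oddharm r \in Zloc p by apply: Zloc_oddharm; lia.
have -> : 2 * sinprod n (x + r%:R) = P * (- 2^-1 / (x + r%:R) * (sinprod n x *
    \prod_(0 <= i < r) ((x + i%:R + n%:R + 1) / (x + i%:R - n%:R)))).
  have := @sinprod_walk _ n r x; move: (\prod_(_ <= _ < _) _) => Q hQ.
  have {}hQ := hQ (fun i ir => (step_unit (leq_trans ir _)).1).
  apply: (mulfI d0); rewrite mulrCA hQ; last by lia.
  by move: d0; move: (x + _) => d d0; field.
have e : sinprod n x *
    \prod_(0 <= i < r) ((x + i%:R + n%:R + 1) / (x + i%:R - n%:R))
    = 1 * (1 + 2 * P * oddharm r) %[p^ 2].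
  have st := @step_prod r ltac:(lia).
  have zst := eqm_Zloc st.
  by apply: eqmM st; [apply: zst; zloc | exact: rpred1 | exact: sinprod_base1].
apply: (eqm_trans (eqm_scale_p (eqmMl _ e))); first by zloc.
exists (- 2^-1 ^+ 5 * r%:R^-1 ^+ 2 / (x + r%:R)
        - oddharm r / 4 / r%:R / (x + r%:R)); first by zloc.
rewrite natrM; move: d0 r0; move: r%:R => t d0 r0; field; rewrite r0 andbT.
by apply: contraNneq d0 => e'; rewrite -(mulr0 (4^-1)) -e'; apply/eqP; field.
Qed.

Lemma hypS_end : (2 * (x + m%:R) + 1) * hypS n (x + m%:R)
  = (2 ^+ (p - 1) - (2 ^+ (p - 1) - 1) ^+ 2) / 2 %[p^ 3].
Proof.
have zP := Zloc_p; have mn := half_half_le.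
have zH := Zloc_harm (leqnn n).
have zO : O \in Zloc p by apply: Zloc_oddharm; lia.
have mix : P ^+ 2 * mixharm m = (h / 4) ^+ 2 %[p^ 3].
  apply: (@eqm_trans _ _ (P ^+ 2 * O ^+ 2)).
    rewrite [P ^+ 2]expr2 -!mulrA; do 2 apply: eqm_scale_p.
    exact: mixharm_quarter.
  have [s zs e] := oddharm_quarter.
  exists (s * (O + harm n / 4)); first by zloc.
  transitivity ((P * O - h / 4) * (P * (O + harm n / 4))); first by field.
  by rewrite e; ring.
rewrite hypS_walk.
apply: (eqm_trans (eqmD hypS_base (eqm_trans sinprod_walk_sum
  (eqmB (eqmN quarter_log) mix)))).
apply: eqm_sym; have [s zs /eqP] := two_pow_eq; rewrite subr_eq => /eqP ->.
set H := harm n in zH *.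
exists (2^-1 * (s - 2 * (- (P * H) / 2 + (P * H / 2) ^+ 2 / 2) * s
   - P ^+ 3 * s ^+ 2 + H ^+ 3 * 2^-1 ^+ 3 - P * H ^+ 4 * 2^-1 ^+ 6)).
  by zloc.
by field.
Qed.

Lemma hypS_quarter : hypS n (- 4^-1)
  = (-1) ^+ n * (2 ^+ (p - 1) - (2 ^+ (p - 1) - 1) ^+ 2) %[p^ 3].
Proof.
set E := _ - _ ^+ 2.
have end2 (c : rat) : c \in Zloc p -> hypS n (- 4^-1) =
    c * ((2 * (x + m%:R) + 1) * hypS n (x + m%:R)) ->
    (-1) ^+ n = c / 2 -> hypS n (- 4^-1) = (-1) ^+ n * E %[p^ 3].
  move=> zc -> ->; rewrite mulrAC -mulrA; apply: eqmMl => //.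
  exact: hypS_end.
have eP : P = 2 * n%:R + 1 by rewrite half_natr; field.
have := odd_double_half n; case: (boolP (odd n)) => on hn.
- have hn' : n = (2 * m + 1)%N by lia.
  have en : n%:R = 2 * m%:R + 1 :> rat by rewrite {1}hn' natrD natrM.
  have ex : x + m%:R = - 1 - - 4^-1 by rewrite eP en; field.
  apply: (end2 (- 2)); first by zloc.
    rewrite ex; have -> : hypS n (- 1 - - 4^-1) = hypS n (- 4^-1) :> rat.
      by apply: eq_bigr => k _; rewrite hypc_refl.
    by field.
  by rewrite -signr_odd on; field.
- have hn' : n = (2 * m)%N by lia.
  have en : n%:R = 2 * m%:R :> rat by rewrite {1}hn' natrM.
  have ex : x + m%:R = - 4^-1 by rewrite eP en; field.
  apply: (end2 2); first by zloc.
    by rewrite ex; field.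
  by rewrite -signr_odd (negbTE on); field.
Qed.

End Localization.

Theorem theorem1p3 (p : nat) (p_prime : prime p) (p_ge5 : (5 <= p)%N) :
  eqmod_Zloc p 3
    (\sum_(0 <= k < ((p - 1) %/ 2).+1)
        ('C(4 * k, 2 * k) * 'C(2 * k, k))%:R / ((2 * k + 1)%:R * 64%:R ^+ k))
    ((-1) ^+ ((p - 1) %/ 2) *
       (2%:R ^+ (p - 1) - (2%:R ^+ (p - 1) - 1) ^+ 2)).
Proof.
have -> : ((p - 1) %/ 2 = p./2)%N by have := p_half p_prime p_ge5; lia.
have -> : \sum_(0 <= k < p./2.+1)
    ('C(4 * k, 2 * k) * 'C(2 * k, k))%:R / ((2 * k + 1)%:R * 64 ^+ k)
    = hypS p./2 (- 4^-1) :> rat.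
  apply: eq_bigr => k _.
  by rewrite hypc_quarter [in RHS]mulrAC invfM mulrA.
exact: hypS_quarter.
Qed.
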